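(* Let $(M,\circ,e,E,\eta)$ be a Dubrovin--Frobenius manifold of dimension $n$ with non-empty caustic $K$, and suppose that for a point $p\in K$ the germ of $M$ at $p$ as an $F$-manifold is isomorphic to $I_2(m)\times (A_1)^{n-2}$ with $m\ge 3$. Assume that the pullback of $\eta$ to $K$ is non-degenerate. Let $V=(V^\alpha_\beta)$ be the matrix of $\mu=\frac{2-d}{2}\mathrm{Id}-\nabla E$ in the orthonormal frame $N,f_2,\dots,f_n$ of $TM|_K$ described in the context. Then the only non-zero entries of the exponent of formal monodromy are $$V^2_1=\frac{\mathrm i}{2}\,\frac{m-2}{m}\qquad\text{and}\qquad V^1_2=-V^2_1=-\frac{\mathrm i}{2}\,\frac{m-2}{m}.$$
   Context: All objects are holomorphic; a metric is a holomorphic non-degenerate symmetric $\mathcal O_M$-bilinear form on $\mathcal T_M$. An $F$-manifold $(M,\circ,e)$ is a complex manifold with a commutative, associative, $\mathcal O_M$-bilinear multiplication $\circ$ on $\mathcal T_M$ with global unit field $e$ such that $\mathcal L_{X\circ Y}(\circ)=X\circ\mathcal L_Y(\circ)+Y\circ\mathcal L_X(\circ)$ for all local vector fields $X,Y$. An Euler vector field is a global vector field $E$ with $\mathcal L_E(\circ)=\circ$. A point $p$ is semisimple if the algebra $T_pM$ has no non-zero nilpotents; the caustic $K$ is the set of non-semisimple points. A Dubrovin--Frobenius manifold $(M,\circ,e,E,\eta)$ is an $F$-manifold with Euler field $E$ and a metric $\eta$ such that: $\eta(X\circ Y,Z)=\eta(X,Y\circ Z)$; $\nabla e=0$ where $\nabla$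 is the Levi-Civita connection of $\eta$; $\mathcal L_E\eta=(2-d)\eta$ for a constant $d$; and $\eta$ is flat. The endomorphism $\mu:=\frac{2-d}{2}\mathrm{Id}-\nabla E$ of $\mathcal T_M$ is $\eta$-antisymmetric. That the germ at $p$ is isomorphic to $I_2(m)\times(A_1)^{n-2}$ means: there are local coordinates $(t,u_2,\dots,u_n)$ on a neighborhood $W$ of $p$, with $\pi_i:=\partial_{u_i}$, such that $\partial_t\circ\partial_t=t^{m-2}\pi_2$, $\partial_t\circ\pi_2=\partial_t$, $\pi_2\circ\pi_2=\pi_2$, $\partial_t\circ\pi_i=0$ and $\pi_2\circ\pi_i=0$ for $i\ge3$, $\pi_i\circ\pi_j=\delta_{ij}\pi_i$ for $i,j\ge3$. The coordinates are chosen so that $E=\frac2m t\,\partial_t+\sum_{i=2}^n u_i\pi_i$. Then $K\cap W=\{t=0\}$, with coordinates $(u_2,\dots,u_n)$. Frame along $K$ near $p$: $N$ is a unit normal vector field to $K$, and $f_i=\pi_i/|\pi_i|$ for $i=2,\dots,n$, with lengths computed by $\eta$. Index $1$ corresponds to $N$ and index $i$ to $f_i$. In this frame $E\circ$ has matrix $U=\mathrm{diag}(u_2,u_2,u_3,\dots,u_n)$ and $\mu$ has antisymmetric matrix $V$, with $V^\alpha_\beta=\eta(f_\alpha,\mu f_\beta)$ ($f_1:=N$). Exponent of formal monodromy: consider the system $\frac{dY}{dz}=\left(\frac1zV-U\right)Y$ at $z=\infty$. A formal gauge transformation $Y=\left(\mathrm{Id}+\sum_{k\ge1}G_kz^{-k}\right)\tilde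 Y$ brings it to the form $\frac{d\tilde Y}{dz}=\left(-U+\sum_{k\ge1}B_kz^{-k}\right)\tilde Y$, where all $B_k$ are block diagonal with one $2\times2$ block (indices $1,2$) and $n-2$ blocks of size $1$. All entries of $B_1$ are zero except for the upper left $2\times2$ block $\begin{pmatrix}0&V^1_2\\ -V^1_2&0\end{pmatrix}$. After $\tilde Y=e^{-Uz}\bar Y$ and a further formal block-diagonal gauge transformation $\bar Y=H_0(\mathrm{Id}+\sum_{k\ge1}H_kz^{-k})\hat Y$ one gets $\frac{d\hat Y}{dz}=\frac Bz\hat Y$ with $B=H_0^{-1}B_1H_0=\mathrm{diag}(\mathrm iV^1_2,-\mathrm iV^1_2,0,\dots,0)$, hence a formal solution $(\text{formal power series in }z^{-1})\,z^{B}e^{-Uz}$. The matrix $B$ is called the exponent of formal monodromy; it is determined by $V^1_2$. *)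

(* Defs.v *)
From mathcomp Require Import all_boot all_order all_algebra.
From mathcomp Require Import classical_sets reals topology normedtype derive.
From mathcomp Require Import complex.
Set Implicit Arguments.
Unset Strict Implicit.
Unset Printing Implicit Defensive.
Import Order.TTheory GRing.Theory Num.Theory numFieldNormedType.Exports.
Local Open Scope classical_set_scope.
Local Open Scope ring_scope.

(* [Cplx R] is R[i] under a name through which the canonical
   topology and normed-module structure of a numClosedFieldType are found. *)
Definition Cplx (R : realType) : numClosedFieldType := R[i].

(* Differentiability is over the complex scalars, so on an open set this is
   holomorphy. *)
Definition holomorphic_on (R : realType) (V W : normedModType (Cplx R))
    (O : set V) (f : V -> W) : Prop :=
  forall x, O x -> differentiable f x.

Record chart (R : realType) (n : nat) (M : topologicalType) := Chart {
  dom : set M;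
  coords : M -> 'rV[Cplx R]_n;
  param : 'rV[Cplx R]_n -> M;
  dom_open : open dom;
  img_open : open (coords @` dom);
  coordsK : forall q, dom q -> param (coords q) = q;
  coords_continuous : forall q, dom q -> {for q, continuous coords};
  param_continuous : forall x, (coords @` dom) x -> {for x, continuous param}
}.

Definition img R n M (phi : chart R n M) : set 'rV[Cplx R]_n :=
  coords phi @` dom phi.

Definition transition R n M (phi psi : chart R n M) :
    'rV[Cplx R]_n -> 'rV[Cplx R]_n :=
  coords psi \o param phi.

Definition compatible R n M (phi psi : chart R n M) : Prop :=
  holomorphic_on (coords phi @` (dom phi `&` dom psi)) (transition phi psi) /\
  holomorphic_on (coords psi @` (dom phi `&` dom psi)) (transition psi phi).

Record complexManifold (R : realType) (n : nat) := ComplexManifold {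
  carrier :> topologicalType;
  atlas : set (chart R n carrier);
  carrier_hausdorff : hausdorff_space carrier;
  carrier_second_countable : @second_countable carrier;
  atlas_cover : forall q : carrier, exists2 phi, atlas phi & dom phi q;
  atlas_compatible : forall phi psi, atlas phi -> atlas psi -> compatible phi psi;
  atlas_maximal : forall phi,
    (forall psi, atlas psi -> compatible phi psi) -> atlas phi
}.

Section LocalGeometry.
Variables (R : realType) (n : nat).
Local Notation C := (Cplx R).
Local Notation T := 'rV[C]_n.

(* Vector fields, multiplications and metrics on an open subset of C^n.  A
   field is the row of its components; [mul x] multiplies tangent vectors at
   x, and [g x] is the Gram matrix of the coordinate fields. *)
Implicit Types (X Y Z : T -> T) (x u v : T)
  (mul : T -> T -> T -> T) (g : T -> 'M[C]_n).

Definition pairing (G : 'M[C]_n) u v : C := (u *m G *m v^T) 0 0.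

Definition bracket X Y x : T := 'D_(X x) Y x - 'D_(Y x) X x.

(* (L_X mul)(Y, Z) *)
Definition lie_mul mul X Y Z x : T :=
  bracket X (fun y => mul y (Y y) (Z y)) x
  - mul x (bracket X Y x) (Z x) - mul x (Y x) (bracket X Z x).

(* (L_X g)(Y, Z) *)
Definition lie_metric g X Y Z x : C :=
  'D_(X x) (fun y => pairing (g y) (Y y) (Z y)) x
  - pairing (g x) (bracket X Y x) (Z x) - pairing (g x) (Y x) (bracket X Z x).

(* Levi-Civita Christoffel symbols applied to u and v: the row w such that
   2 g(w, e_k) = (D_u g)(v, e_k) + (D_v g)(u, e_k) - (D_{e_k} g)(u, v). *)
Definition christoffel g x u v : T :=
  2^-1 *: (\row_k (pairing ('D_u g x) v (delta_mx 0 k)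
                   + pairing ('D_v g x) u (delta_mx 0 k)
                   - pairing ('D_(delta_mx 0 k) g x) u v)) *m invmx (g x).

(* nabla_v Y at x, for v a tangent vector at x and Y a vector field *)
Definition nabla g v Y x : T := 'D_v Y x + christoffel g x v (Y x).

Definition curvature g X Y Z x : T :=
  nabla g (X x) (fun y => nabla g (Y y) Z y) x
  - nabla g (Y x) (fun y => nabla g (X y) Z y) x
  - nabla g (bracket X Y x) Z x.

End LocalGeometry.

(* Tensor fields on M are given by their components in every chart of the
   atlas, as functions of the coordinates, subject to the transformation law
   under the differential of the transition maps. *)
Definition same_point R n (M : complexManifold R n) (phi psi : chart R n M)
    (q : M) : Prop :=
  [/\ atlas phi, atlas psi, dom phi q & dom psi q].

Definition pushforward R n M (phi psi : chart R n M) (q : M)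
    (v : 'rV[Cplx R]_n) : 'rV[Cplx R]_n :=
  'D_v (transition phi psi) (coords phi q).

Record vectorField R n (M : complexManifold R n) := VectorField {
  vf :> chart R n M -> 'rV[Cplx R]_n -> 'rV[Cplx R]_n;
  vf_holomorphic : forall phi, atlas phi -> holomorphic_on (img phi) (vf phi);
  vf_tensor : forall phi psi q, same_point phi psi q ->
    vf psi (coords psi q) = pushforward phi psi q (vf phi (coords phi q))
}.

Record metric R n (M : complexManifold R n) := Metric {
  mt :> chart R n M -> 'rV[Cplx R]_n -> 'M[Cplx R]_n;
  mt_holomorphic : forall phi, atlas phi -> holomorphic_on (img phi) (mt phi);
  mt_sym : forall phi x, atlas phi -> img phi x -> (mt phi x)^T = mt phi x;
  mt_nondegenerate : forall phi x, atlas phi -> img phi x ->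
    mt phi x \in unitmx;
  mt_tensor : forall phi psi q, same_point phi psi q -> forall u v,
    pairing (mt psi (coords psi q)) (pushforward phi psi q u)
            (pushforward phi psi q v)
    = pairing (mt phi (coords phi q)) u v
}.

Record Fmanifold R n (M : complexManifold R n) := FManifold {
  circ : chart R n M ->
    'rV[Cplx R]_n -> 'rV[Cplx R]_n -> 'rV[Cplx R]_n -> 'rV[Cplx R]_n;
  unit_field : vectorField M;
  mul_linear : forall phi x, atlas phi -> img phi x -> forall a u v w,
    circ phi x (a *: u + v) w = a *: circ phi x u w + circ phi x v w;
  mul_comm : forall phi x, atlas phi -> img phi x -> forall u v,
    circ phi x u v = circ phi x v u;
  mul_assoc : forall phi x, atlas phi -> img phi x -> forall u v w,
    circ phi x (circ phi x u v) w = circ phi x u (circ phi x v w);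
  mul_unit : forall phi x, atlas phi -> img phi x -> forall u,
    circ phi x (unit_field phi x) u = u;
  mul_holomorphic : forall phi, atlas phi -> forall u v,
    holomorphic_on (img phi) (fun x => circ phi x u v);
  mul_tensor : forall phi psi q, same_point phi psi q -> forall u v,
    circ psi (coords psi q) (pushforward phi psi q u) (pushforward phi psi q v)
    = pushforward phi psi q (circ phi (coords phi q) u v);
  mul_hertling_manin : forall phi, atlas phi ->
    forall O, open O -> O `<=` img phi ->
    forall X Y Z W : 'rV[Cplx R]_n -> 'rV[Cplx R]_n,
      holomorphic_on O X -> holomorphic_on O Y ->
      holomorphic_on O Z -> holomorphic_on O W ->
    forall x, O x ->
      lie_mul (circ phi) (fun y => circ phi y (X y) (Y y)) Z W x
      = circ phi x (X x) (lie_mul (circ phi) Y Z W x)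
        + circ phi x (Y x) (lie_mul (circ phi) X Z W x)
}.

Definition is_euler R n (M : complexManifold R n) (F : Fmanifold M)
    (E : vectorField M) : Prop :=
  forall phi, atlas phi -> forall O, open O -> O `<=` img phi ->
  forall Y Z : 'rV[Cplx R]_n -> 'rV[Cplx R]_n,
    holomorphic_on O Y -> holomorphic_on O Z ->
  forall x, O x -> lie_mul (circ F phi) (E phi) Y Z x = circ F phi x (Y x) (Z x).

Record DFmanifold R n (M : complexManifold R n) := DFManifold {
  df_F :> Fmanifold M;
  euler : vectorField M;
  eta : metric M;
  charge : Cplx R;
  df_euler : is_euler df_F euler;
  eta_mul : forall phi x, atlas phi -> img phi x -> forall u v w,
    pairing (eta phi x) (circ df_F phi x u v) w
    = pairing (eta phi x) u (circ df_F phi x v w);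
  unit_flat : forall phi x, atlas phi -> img phi x -> forall v,
    nabla (eta phi) v (unit_field df_F phi) x = 0;
  eta_homogeneous : forall phi, atlas phi ->
    forall O, open O -> O `<=` img phi ->
    forall Y Z : 'rV[Cplx R]_n -> 'rV[Cplx R]_n,
      holomorphic_on O Y -> holomorphic_on O Z ->
    forall x, O x ->
      lie_metric (eta phi) (euler phi) Y Z x
      = (2 - charge) * pairing (eta phi x) (Y x) (Z x);
  eta_flat : forall phi, atlas phi ->
    forall O, open O -> O `<=` img phi ->
    forall X Y Z : 'rV[Cplx R]_n -> 'rV[Cplx R]_n,
      holomorphic_on O X -> holomorphic_on O Y -> holomorphic_on O Z ->
    forall x, O x -> curvature (eta phi) X Y Z x = 0
}.

(* [iter k (circ F phi x v) v] is the power v^(k+1). *)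
Definition caustic R n (M : complexManifold R n) (F : Fmanifold M) : set M :=
  [set q | exists phi, [/\ atlas phi, dom phi q &
    exists v, v != 0 /\ exists k, iter k (circ F phi (coords phi q) v) v = 0]].

Definition mu_endo R n (M : complexManifold R n) (D : DFmanifold M)
    (phi : chart R n M) (x v : 'rV[Cplx R]_n) : 'rV[Cplx R]_n :=
  ((2 - charge D) / 2) *: v - nabla (eta D phi) v (euler D phi) x.

Section NormalForm.
Variables (R : realType) (n : nat) (M : complexManifold R n.+2).
Local Notation C := (Cplx R).
Local Notation T := 'rV[C]_n.+2.

(* The manifold has dimension n.+2.  Index 0 is the coordinate t (and, in
   frames, the normal direction); index i > 0 is the coordinate u_(i+1), so
   that [partial 0] is d/dt, [partial 1] is pi_2, and so on. *)
Definition partial (i : 'I_n.+2) : T := delta_mx 0 i.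

Definition I2A1_coordinates (F : Fmanifold M) (m : nat)
    (phi : chart R n.+2 M) : Prop :=
  forall x, img phi x ->
  [/\ [/\ circ F phi x (partial 0) (partial 0)
            = (x 0 0) ^+ (m - 2) *: partial 1,
          circ F phi x (partial 0) (partial 1) = partial 0 &
          circ F phi x (partial 1) (partial 1) = partial 1],
      forall i : 'I_n.+2, (1 < i)%N ->
        circ F phi x (partial 0) (partial i) = 0 /\
        circ F phi x (partial 1) (partial i) = 0 &
      forall i j : 'I_n.+2, (1 < i)%N -> (1 < j)%N ->
        circ F phi x (partial i) (partial j) = (i == j)%:R *: partial i].

Definition euler_coordinates (E : vectorField M) (m : nat)
    (phi : chart R n.+2 M) : Prop :=
  forall x, img phi x ->
    E phi x = (2 / m%:R * x 0 0) *: partial 0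
              + \sum_(i < n.+2 | i != 0) x 0 i *: partial i.

(* In coordinates as above the caustic is {t = 0}, so its tangent space at q
   consists of the v with dt(v) = 0. *)
Definition caustic_pullback_nondegenerate (D : DFmanifold M)
    (phi : chart R n.+2 M) (q : M) : Prop :=
  forall u : T, u 0 0 = 0 ->
    (forall v : T, v 0 0 = 0 -> pairing (eta D phi (coords phi q)) u v = 0) ->
    u = 0.

(* N followed by f_i = pi_i / r_i; [r i] is a choice of the length |pi_i|. *)
Definition frame (N : T) (r : 'I_n.+2 -> C) (i : 'I_n.+2) : T :=
  if i == 0 then N else (r i)^-1 *: partial i.

Definition is_unit_normal (D : DFmanifold M) (phi : chart R n.+2 M) (q : M)
    (N : T) : Prop :=
  pairing (eta D phi (coords phi q)) N N = 1 /\
  forall v : T, v 0 0 = 0 -> pairing (eta D phi (coords phi q)) N v = 0.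

Definition are_lengths (D : DFmanifold M) (phi : chart R n.+2 M) (q : M)
    (r : 'I_n.+2 -> C) : Prop :=
  forall i, i != 0 ->
    r i ^+ 2 = pairing (eta D phi (coords phi q)) (partial i) (partial i).

(* Matrix, with entries eta(f_i, A f_j), of an endomorphism A of the tangent
   space at q. *)
Definition frame_matrix (D : DFmanifold M) (phi : chart R n.+2 M) (q : M)
    (f : 'I_n.+2 -> T) (A : T -> T) : 'M[C]_n.+2 :=
  \matrix_(i, j) pairing (eta D phi (coords phi q)) (f i) (A (f j)).

Definition Umx (D : DFmanifold M) phi q f : 'M[C]_n.+2 :=
  frame_matrix D phi q f
    (circ D phi (coords phi q) (euler D phi (coords phi q))).

Definition Vmx (D : DFmanifold M) phi q f : 'M[C]_n.+2 :=
  frame_matrix D phi q f (mu_endo D phi (coords phi q)).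

End NormalForm.

Section FormalMonodromy.
Variables (K : numClosedFieldType) (n : nat).

(* A sequence A stands for the formal series \sum_k A_k z^-k. *)
Implicit Types (A B G H : nat -> 'M[K]_n.+2) (U V : 'M[K]_n.+2).

Definition fs_mul A B k : 'M[K]_n.+2 := \sum_(i < k.+1) A i *m B (k - i)%N.

(* d/dz: the coefficient of z^-k is - (k - 1) A_(k-1) *)
Definition fs_deriv A k : 'M[K]_n.+2 := - (k.-1%:R *: A k.-1).

(* Y = G Y' transforms dY/dz = A Y into dY'/dz = B Y'. *)
Definition formal_gauge A G B : Prop :=
  forall k, fs_deriv G k + fs_mul G B k = fs_mul A G k.

(* one 2 x 2 block with indices 0, 1, and n blocks of size 1 *)
Definition block_diagonal (X : 'M[K]_n.+2) : Prop :=
  forall i j : 'I_n.+2, i != j -> ~~ ((i < 2) && (j < 2))%N -> X i j = 0.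

(* the system dY/dz = (z^-1 V - U) Y *)
Definition fs_system U V (k : nat) : 'M[K]_n.+2 :=
  match k with 0 => - U | 1 => V | _ => 0 end.

Definition fs_residue (X : 'M[K]_n.+2) (k : nat) : 'M[K]_n.+2 :=
  if k == 1%N then X else 0.

(* Effect of the substitution Y = exp(- U z) Y' on the coefficients of a system
   whose coefficients commute with U, which is the case of the block-diagonal
   ones here since U is scalar on each block. *)
Definition fs_exp_shift U A (k : nat) : 'M[K]_n.+2 :=
  if k == 0%N then A 0%N + U else A k.

(* B1 is the z^-1 coefficient of a block-diagonalization of the system, and B
   the exponent of formal monodromy resulting from it.  The last condition of
   [formal_monodromy] fixes the order of the two eigenvalues of the 2 x 2
   block of B1. *)
Definition formal_monodromy U V (B1 B : 'M[K]_n.+2) : Prop :=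
  exists G Bs H,
  [/\ [/\ G 0%N = 1%:M, Bs 0%N = - U, Bs 1%N = B1 &
          formal_gauge (fs_system U V) G Bs],
      forall k, block_diagonal (Bs k),
      [/\ H 0%N \in unitmx, forall k, block_diagonal (H k) &
          formal_gauge (fs_exp_shift U Bs) H (fs_residue B)],
      is_diag_mx B &
      B 0 0 = 'i * V 0 1].

End FormalMonodromy.

(* Main.v *)
Require Import Defs.
From mathcomp Require Import all_boot all_order all_algebra.
From mathcomp Require Import boolp classical_sets functions reals topology.
From mathcomp Require Import normedtype derive.
From mathcomp Require Import complex.
From mathcomp Require Import ring.
Set Implicit Arguments.
Unset Strict Implicit.
Unset Printing Implicit Defensive.
Import Order.TTheory GRing.Theory Num.Theory numFieldNormedType.Exports.
Local Open Scope classical_set_scope.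
Local Open Scope ring_scope.

(** Contracting the defining conditions with the metric gives
    [eta(mu v, w) = - 1/2 d(eta(E, -))(v, w)].  In the normal form eta pairs
    d/dt and pi_2 only with each other, and [eta(d/dt, d/dt) = t^(m-2)
    eta(pi_2, pi_2)] vanishes on the caustic.  Closedness of [eta(e, -)] cancels
    the derivatives of the metric in [d(eta(E, -))(d/dt, pi_2)], which leaves
    [(2/m - 1) eta(d/dt, pi_2)].  The unit normal is [N = a d/dt + b pi_2] with
    [(b |pi_2|)^2 = -1], so [eta(d/dt, pi_2)] cancels from [V^2_1].  On the
    formal side, [B_1 = V + [G_1, U]] and [H_0 B = B_1 H_0]. *)

(** * Formal gauge transformations at order z^-1 *)

Section FormalPart.
Variables (K : numClosedFieldType) (n : nat).
Implicit Types (U V B : 'M[K]_n.+2).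

(* Order z^-1 of the block diagonalization: since U is scalar on each block,
   [G_1, U] has no block-diagonal part. *)
Lemma block_residue U V (Bs G : nat -> 'M[K]_n.+2) :
    is_diag_mx U -> U 0 0 = U 1 1 ->
    V 0 0 = 0 -> V 1 1 = 0 -> (forall i : 'I_n.+2, (1 < i)%N -> V i i = 0) ->
    G 0%N = 1%:M -> Bs 0%N = - U -> formal_gauge (fs_system U V) G Bs ->
    block_diagonal (Bs 1%N) ->
  Bs 1%N = V 0 1 *: delta_mx 0 1 + V 1 0 *: delta_mx 1 0.
Proof.
move=> /is_diag_mxP dU U01 V00 V11 Vii G0 B0 /(_ 1%N) gauge blk.
have B1E : Bs 1%N = V + (G 1%N *m U - U *m G 1%N).
  (* At order 1 the factor [k.-1] is 0, so the derivative of G contributes nothing. *)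
  move: gauge; rewrite /fs_deriv /fs_mul !big_ord_recl !big_ord0 /= /bump /=.
  rewrite !addr0 ?subnn ?subn0 scale0r oppr0 add0r G0 B0 mul1mx mulmx1 mulmxN.
  rewrite mulNmx => /(canRL (addrK _)) ->.
  by rewrite opprK [- _ + V]addrC -addrA [- _ + _]addrC.
(* As U is diagonal, the (i, j) entry of the commutator is [G 1 i j * (U j j - U i i)]. *)
have commE i j : U i i = U j j -> (G 1%N *m U - U *m G 1%N) i j = 0.
  move=> eqU; rewrite !mxE (bigD1 j) //= big1 ?addr0; last first.
    by move=> k kj; rewrite dU ?mulr0.
  rewrite (bigD1 i) //= big1 ?addr0; last first.
    by move=> k ki; rewrite (dU i k) ?mul0r // eq_sym.
  by rewrite eqU mulrC subrr.
have ltn2 (k : 'I_n.+2) : (k < 2)%N -> k = 0 \/ k = 1.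
  case: k => [[|[|k]] ltk] //= _; [left|right]; exact: val_inj.
apply/matrixP => i j; have [ij|ij] := eqVneq i j.
  subst j; have -> : Bs 1%N i i = V i i.
    by rewrite B1E mxE commE // addr0.
  rewrite !mxE; case: i => [[|[|i]] lti] /=.
  - have -> : Ordinal lti = 0 by exact: val_inj.
    by rewrite V00 !mulr0 addr0.
  - have -> : Ordinal lti = 1 by exact: val_inj.
    by rewrite V11 !mulr0 addr0.
  - by rewrite Vii // !mulr0 addr0.
case: (boolP ((i < 2) && (j < 2))%N) => [/andP[/ltn2 + /ltn2]|nij].
  move=> i01 j01; rewrite B1E mxE commE; last first.
    by case: i01 j01 => -> [->|->].
  by move: ij; case: i01 j01 => -> [->|->]; rewrite ?eqxx // !mxE /=
    ?mulr0 ?mulr1 ?addr0 ?add0r.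
rewrite blk //; move: nij; rewrite !mxE.
case: (eqVneq i 0) => i0; case: (eqVneq j 1) => j1; rewrite ?i0 ?j1 //=;
case: (eqVneq i 1) => i1; case: (eqVneq j 0) => j0; rewrite ?i1 ?j0 //=;
  by rewrite !mulr0 addr0.
Qed.

(** The z^-1 coefficient of the second gauge equation: the exponential shift cancels the constant
    term of A, and the derivative of H again enters with factor 0. *)
Lemma residue_conjugation U (A H : nat -> 'M[K]_n.+2) B :
    A 0%N = - U -> formal_gauge (fs_exp_shift U A) H (fs_residue B) ->
  H 0%N *m B = A 1%N *m H 0%N.
Proof.
move=> A0 /(_ 1%N); rewrite /fs_deriv /fs_mul !big_ord_recl !big_ord0 /= /bump /=.
rewrite /fs_exp_shift /fs_residue /= A0 addNr mul0mx mulmx0 !addr0 scale0r.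
by rewrite oppr0 !add0r.
Qed.

(** B is similar to B1, which is traceless and vanishes outside the 2 x 2 block; block-diagonality
    of [H0] confines B to the same block. *)
Lemma diag_conjugate_block (H0 B1 B : 'M[K]_n.+2) (b c : K) :
    H0 \in unitmx -> block_diagonal H0 -> is_diag_mx B ->
    B1 = b *: delta_mx 0 1 + c *: delta_mx 1 0 -> H0 *m B = B1 *m H0 ->
  B = B 0 0 *: (delta_mx 0 0 - delta_mx 1 1).
Proof.
move=> uH bH /is_diag_mxP dB B1E HB.
have Bjj (j : 'I_n.+2) : (1 < j)%N -> B j j = 0.
  move=> j1.
  have offj i : i != j -> H0 i j = 0.
    by move=> ij; apply: bH => //; rewrite (ltnNge j) j1 andbF.
  (* Column j of [H0] has at most this one non-zero entry, so its vanishing would make the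
     determinant 0. *)
  have Hjj : H0 j j != 0.
    apply/eqP => Hj; move: uH; rewrite unitmxE (expand_det_col _ j).
    rewrite big1 ?unitr0 // => i _.
    by have [->|/offj->] := eqVneq i j; rewrite ?Hj mul0r.
  have := congr1 (fun X : 'M_n.+2 => X j j) HB; rewrite B1E /= !mxE.
  rewrite (bigD1 j) //= big1 ?addr0; last first.
    by move=> i ij; rewrite (dB i j) ?mulr0.
  have j0 : j == 0 = false by apply/negP => /eqP j0; move: j1; rewrite j0.
  have jn1 : j == 1 = false by apply/negP => /eqP jn; move: j1; rewrite jn.
  rewrite big1 => [/eqP|i _]; first by rewrite mulf_eq0 (negPf Hjj) => /eqP.
  by rewrite !mxE j0 jn1 !mulr0 addr0 mul0r.
(* The two entries left are opposite, as B1 is traceless. *)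
have trB : \tr B = 0.
  have -> : B = invmx H0 *m (B1 *m H0) by rewrite -HB mulKmx.
  rewrite mulmxA mxtrace_mulC mulmxA mulmxV // mul1mx B1E mxtraceD !mxtraceZ.
  have tr0 (i j : 'I_n.+2) : i != j -> \tr (delta_mx i j : 'M[K]_n.+2) = 0.
    move=> ij; apply: big1 => k _; rewrite mxE.
    by case: (eqVneq k i) => [->|] //=; rewrite (negPf ij).
  by rewrite !tr0 // !mulr0 addr0.
have B11 : B 1 1 = - B 0 0.
  move: trB; rewrite /mxtrace !big_ord_recl big1 ?addr0.
    have -> : lift ord0 ord0 = 1 :> 'I_n.+2 by exact: val_inj.
    by rewrite addrC => /eqP; rewrite addr_eq0 => /eqP.
  by move=> i _; apply: Bjj.
apply/matrixP => i j; rewrite !mxE; have [ij|ij] := eqVneq i j; last first.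
  rewrite dB //; case: (eqVneq i 0) => i0; case: (eqVneq i 1) => i1 //=.
  - by rewrite -i0 eq_sym (negPf ij) -i1 eq_sym (negPf ij) subrr mulr0.
  - by rewrite -i0 eq_sym (negPf ij) subrr mulr0.
  - by rewrite -i1 eq_sym (negPf ij) subrr mulr0.
  - by rewrite subrr mulr0.
subst j; case: (eqVneq i 0) => [->|i0]; first by rewrite subr0 mulr1.
case: (eqVneq i 1) => [->|i1]; first by rewrite sub0r mulrN1 B11.
rewrite subr0 mulr0 Bjj //; move: i0 i1; case: i => [[|[|i]] lti] //.
Qed.

End FormalPart.

(** * Directional derivatives of matrix entries *)

Section MatrixDerivatives.
Variables (K : numFieldType) (V : normedModType K) (m n : nat).

Lemma is_derive_entry (A : V -> 'M[K]_(m, n)) (x v : V) i j :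
  differentiable A x -> is_derive x v (fun y => A y i j) ('D_v A x i j).
Proof.
move=> dA; pose f := fun N : 'M[K]_(m, n) => N i j : K.
have df := differentiable_coord (A x) i j.
apply: DeriveDef; first exact/diff_derivable/(differentiable_comp dA df).
rewrite !deriveE //; last exact: (differentiable_comp dA df).
have -> : 'd (fun y => A y i j : K) x = 'd f (A x) \o 'd A x :> (V -> K).
  exact: (diff_comp dA df).
(* Packaged as a continuous linear map, the coordinate projection is its own differential. *)
have @l : {linear 'M[K]_(m, n) -> K}.
  by exists f; do 2![eexists]; do ?[constructor];
    rewrite /f ?mxE // => ? *; rewrite ?mxE //; move=> ?; rewrite !mxE.
have lE : f = l by [].
by rewrite /= lE diff_lin //; exact: coord_continuous.
Qed.

End MatrixDerivatives.

(** * Bilinear algebra and the Leibniz rule for the pairing *)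

Section Pairing.
Variables (R : realType) (n : nat).
Local Notation C := (Cplx R).
Implicit Types (G : 'M[C]_n) (u v w : 'rV[C]_n).

Lemma pairingDl G u v w : pairing G (u + v) w = pairing G u w + pairing G v w.
Proof. by rewrite /pairing !mulmxDl mxE. Qed.

Lemma pairingZl G a u w : pairing G (a *: u) w = a * pairing G u w.
Proof. by rewrite /pairing -!scalemxAl mxE. Qed.

Lemma pairing0l G w : pairing G 0 w = 0.
Proof. by rewrite /pairing !mul0mx mxE. Qed.

Lemma pairingNl G u w : pairing G (- u) w = - pairing G u w.
Proof. by rewrite /pairing !mulNmx mxE. Qed.

Lemma pairingDr G u v w : pairing G w (u + v) = pairing G w u + pairing G w v.
Proof. by rewrite /pairing linearD mulmxDr mxE. Qed.

Lemma pairingZr G a u w : pairing G w (a *: u) = a * pairing G w u.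
Proof. by rewrite /pairing linearZ -scalemxAr mxE. Qed.

Lemma pairing0r G w : pairing G w 0 = 0.
Proof. by rewrite /pairing trmx0 mulmx0 mxE. Qed.

Lemma pairingNr G u w : pairing G w (- u) = - pairing G w u.
Proof. by rewrite /pairing linearN mulmxN mxE. Qed.

Lemma pairingC G u v : G^T = G -> pairing G u v = pairing G v u.
Proof.
move=> sG; rewrite /pairing.
transitivity ((u *m G *m v^T)^T 0 0); first by rewrite [RHS]mxE.
by rewrite trmx_mul trmx_mul trmxK sG mulmxA.
Qed.

Lemma pairingE G u v : pairing G u v = \sum_i \sum_j u 0 i * G i j * v 0 j.
Proof.
rewrite /pairing mxE exchange_big; apply: eq_bigr => j _.
by rewrite !mxE mulr_suml.
Qed.

Lemma pairing_suml I (s : seq I) P (F : I -> 'rV[C]_n) G w :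
  pairing G (\sum_(i <- s | P i) F i) w = \sum_(i <- s | P i) pairing G (F i) w.
Proof.
by elim/big_rec2: _ => [|i y x _ <-]; rewrite ?pairing0l ?pairingDl.
Qed.

Lemma pairing_sumr I (s : seq I) P (F : I -> 'rV[C]_n) G w :
  pairing G w (\sum_(i <- s | P i) F i) = \sum_(i <- s | P i) pairing G w (F i).
Proof.
by elim/big_rec2: _ => [|i y x _ <-]; rewrite ?pairing0r ?pairingDr.
Qed.

Lemma pairing_row_sum G u w :
  pairing G u w = \sum_k w 0 k * pairing G u (delta_mx 0 k).
Proof.
rewrite [X in pairing _ _ X]row_sum_delta pairing_sumr.
by apply: eq_bigr => k _; rewrite pairingZr.
Qed.

(** The row has the shape of the one in [christoffel], with [F k] as the derivative of the metric
    along the k-th coordinate; linearity assembles the [F k] into the derivative along w. *)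
Lemma pairing_koszul_row (A B : 'M[C]_n) (F : 'I_n -> 'M[C]_n) u v w :
  ((\row_k (pairing A u (delta_mx 0 k) + pairing B v (delta_mx 0 k)
            - pairing (F k) v u)) *m w^T) 0 0 =
  pairing A u w + pairing B v w - pairing (\sum_k w 0 k *: F k) v u.
Proof.
have -> : pairing (\sum_k w 0 k *: F k) v u = \sum_k w 0 k * pairing (F k) v u.
  rewrite /pairing mulmx_sumr mulmx_suml summxE; apply: eq_bigr => k _.
  by rewrite -scalemxAr -scalemxAl mxE.
rewrite (pairing_row_sum A u w) (pairing_row_sum B v w) mxE -big_split -sumrB.
by apply: eq_bigr => k _ /=; rewrite !mxE -mulrDr -mulrBr mulrC.
Qed.

Lemma is_derive_pairing (g : 'rV[C]_n -> 'M[C]_n) (Y : 'rV[C]_n -> 'rV[C]_n)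
    (x v w : 'rV[C]_n) :
    differentiable g x -> differentiable Y x ->
  is_derive x v (fun y => pairing (g y) (Y y) w)
    (pairing ('D_v g x) (Y x) w + pairing (g x) ('D_v Y x) w).
Proof.
move=> dg dY.
have -> : (fun y => pairing (g y) (Y y) w) =
  \sum_i \sum_j (w 0 j \*: ((fun y => Y y 0 i : C) * (fun y => g y i j : C))).
  apply/funext => y; rewrite pairingE fct_sumE; apply: eq_bigr => i _.
  by rewrite fct_sumE; apply: eq_bigr => j _; rewrite /= mulrC.
suff <- : \sum_i \sum_j (w 0 j *:
    (Y x 0 i *: 'D_v g x i j + g x i j *: 'D_v Y x 0 i)) =
    pairing ('D_v g x) (Y x) w + pairing (g x) ('D_v Y x) w.
  apply: is_derive_sum => i; apply: is_derive_sum => j.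
  apply: is_deriveZ; apply: is_deriveM; exact: is_derive_entry.
rewrite !pairingE -big_split; apply: eq_bigr => i _.
rewrite -big_split; apply: eq_bigr => j _ /=.
by rewrite /GRing.scale /=; ring.
Qed.

Lemma derive_pairing (g : 'rV[C]_n -> 'M[C]_n) (Y : 'rV[C]_n -> 'rV[C]_n)
    (x v w : 'rV[C]_n) :
    differentiable g x -> differentiable Y x ->
  'D_v (fun y => pairing (g y) (Y y) w) x =
  pairing ('D_v g x) (Y x) w + pairing (g x) ('D_v Y x) w.
Proof. by move=> dg dY; have [_] := is_derive_pairing v w dg dY. Qed.

End Pairing.

(** * The Levi-Civita connection via the Koszul formula *)

Lemma half_sum_sub (K : numFieldType) (a b c s : K) :
  a + b = s * c -> s / 2 * c - a = - 2^-1 * (a - b).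
Proof. by move=> abc; rewrite mulrAC -abc; field. Qed.

(** Here and in [koszul_sym], p and q stand for g(D_v Y, w) and g(D_w Y, v), while a, b, c stand for
    (D_v g)(Y, w), (D_w g)(Y, v), (D_Y g)(v, w). *)
Lemma koszul_antisym (K : numFieldType) (a b c p q : K) :
  p + 2^-1 * (a + c - b) - (q + 2^-1 * (b + c - a)) = (a + p) - (b + q).
Proof. by field. Qed.

Lemma koszul_sym (K : numFieldType) (a b c p q : K) :
  p + 2^-1 * (a + c - b) + (q + 2^-1 * (b + c - a)) = c - - p - - q.
Proof. by field. Qed.

Section LeviCivita.
Variables (R : realType) (n : nat).
Local Notation C := (Cplx R).
Local Notation T := 'rV[C]_n.
Variables (g : T -> 'M[C]_n) (x : T).
Hypotheses (dg : differentiable g x) (ug : g x \in unitmx)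
  (sg : \forall y \near x, (g y)^T = g y).

Lemma derive_metric_sym v : ('D_v g x)^T = 'D_v g x.
Proof.
apply/matrixP => i j; rewrite mxE.
rewrite -(derive_val (is_derive := is_derive_entry v j i dg)).
rewrite -(derive_val (is_derive := is_derive_entry v i j dg)).
apply: near_eq_derive; apply: filterS sg => y gy.
by rewrite -{1}gy mxE.
Qed.

Lemma derive_metric_row w :
  'D_w g x = \sum_k w 0 k *: 'D_(delta_mx 0 k) g x.
Proof.
rewrite deriveE // {1}(row_sum_delta w) linear_sum; apply: eq_bigr => k _.
by rewrite linearZ deriveE.
Qed.

(* The Koszul formula, with constant vectors v and w. *)
Lemma pairing_nabla Y v w :
  pairing (g x) (nabla g v Y x) w = pairing (g x) ('D_v Y x) w
    + 2^-1 * (pairing ('D_v g x) (Y x) w + pairing ('D_(Y x) g x) v w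
              - pairing ('D_w g x) v (Y x)).
Proof.
rewrite /nabla pairingDl; congr (_ + _).
(* The Gram matrix cancels the inverse in [christoffel], leaving its row of Koszul terms against
   w. *)
rewrite {1}/pairing /christoffel mulmxKV // -scalemxAl mxE; congr (_ * _).
by rewrite (derive_metric_row w) pairing_koszul_row.
Qed.

Variable Y : T -> T.
Hypothesis dY : differentiable Y x.

(** The right side is the exterior derivative of the 1-form g(Y, -) on constant fields. The term
    (D_Y g)(v, w) is symmetric in v and w and drops out of the difference. *)
Lemma pairing_nabla_antisym v w :
  pairing (g x) (nabla g v Y x) w - pairing (g x) (nabla g w Y x) v =
  'D_v (fun y => pairing (g y) (Y y) w) x
  - 'D_w (fun y => pairing (g y) (Y y) v) x.
Proof.
apply: (etrans (congr2 (fun a b => a - b) (pairing_nabla Y v w)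
                                          (pairing_nabla Y w v))).
apply: (etrans _ (esym (congr2 (fun a b => a - b) (derive_pairing v w dg dY)
                                                  (derive_pairing w v dg dY)))).
move: (derive_metric_sym v) (derive_metric_sym w) (derive_metric_sym (Y x)).
move: ('D_v g x) ('D_w g x) ('D_(Y x) g x) => A B G sA sB sG /=.
rewrite (pairingC w v sG) (pairingC v (Y x) sB) (pairingC w (Y x) sA).
exact: koszul_antisym.
Qed.

Lemma pairing_nabla_sym v w :
  pairing (g x) (nabla g v Y x) w + pairing (g x) (nabla g w Y x) v =
  lie_metric g Y (fun=> v) (fun=> w) x.
Proof.
have dcst (u : T) : differentiable (fun _ : T => u) x by exact: differentiable_cst.
apply: (etrans (congr2 (fun a b => a + b) (pairing_nabla Y v w)
                                          (pairing_nabla Y w v))).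
(* For a constant field v the bracket [Y, v] is - D_v Y. *)
rewrite /lie_metric /bracket (derive_pairing (Y x) w dg (dcst v)) !derive_cst.
move: (derive_metric_sym v) (derive_metric_sym w) (derive_metric_sym (Y x)).
move: ('D_v g x) ('D_w g x) ('D_(Y x) g x) => A B G sA sB sG /=.
move: ('D_v Y x) ('D_w Y x) => a b.
rewrite !sub0r pairing0l pairingNl pairingNr (pairingC v b (nbhs_singleton sg)).
rewrite (pairingC w v sG) (pairingC v (Y x) sB) (pairingC w (Y x) sA).
rewrite addr0; exact: koszul_sym.
Qed.

End LeviCivita.

(** * The 1-forms eta(E, -) and eta(e, -) *)

Lemma near_img (R : realType) n (M : topologicalType) (phi : chart R n M) x :
  img phi x -> \forall y \near x, img phi y.
Proof. by move=> ix; apply: open_nbhs_nbhs; split=> //; exact: img_open. Qed.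

Section DubrovinFrobenius.
Variables (R : realType) (n : nat) (M : complexManifold R n) (D : DFmanifold M).
Variables (phi : chart R n M) (x : 'rV[Cplx R]_n).
Hypotheses (aphi : atlas phi) (ix : img phi x).
Local Notation g := (eta D phi).

Let dg : differentiable g x.
Proof. exact: mt_holomorphic. Qed.

Let ug : g x \in unitmx.
Proof. exact: mt_nondegenerate. Qed.

Let sg : \forall y \near x, (g y)^T = g y.
Proof. by apply: filterS (near_img ix) => y iy; exact: mt_sym. Qed.

(* [L_E eta = (2 - d) eta] fixes the symmetric part of [nabla E], so that mu is
   minus one half of the exterior derivative of the 1-form [eta(E, -)]. *)
Lemma pairing_mu v w :
  pairing (g x) (mu_endo D phi x v) w =
  - 2^-1 * ('D_v (fun y => pairing (g y) (euler D phi y) w) x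
            - 'D_w (fun y => pairing (g y) (euler D phi y) v) x).
Proof.
have dE : differentiable (euler D phi) x by exact: vf_holomorphic.
have dcst (u : 'rV[Cplx R]_n) :
    holomorphic_on (img phi) (fun _ : 'rV[Cplx R]_n => u).
  by move=> y _; exact: differentiable_cst.
have hom := eta_homogeneous D aphi (@img_open _ _ _ phi) (@subset_refl _ _)
  (dcst v) (dcst w) ix.
rewrite /mu_endo pairingDl pairingNl pairingZl.
rewrite (half_sum_sub (etrans (pairing_nabla_sym dg ug sg (euler D phi) v w) hom)).
congr (_ * _); exact: pairing_nabla_antisym.
Qed.

Lemma pairing_mu_antisym v w :
  pairing (g x) (mu_endo D phi x v) w = - pairing (g x) (mu_endo D phi x w) v.
Proof.
apply: (etrans (pairing_mu v w)).
apply: (etrans _ (esym (congr1 -%R (pairing_mu w v)))).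
by rewrite -mulrN opprB.
Qed.

(** The difference of the two sides is the antisymmetrized covariant derivative of e, and e is
    parallel. *)
Lemma unit_flat_closed v w :
  'D_v (fun y => pairing (g y) (unit_field D phi y) w) x =
  'D_w (fun y => pairing (g y) (unit_field D phi y) v) x.
Proof.
have de : differentiable (unit_field D phi) x by exact: vf_holomorphic.
apply: subr0_eq; apply: (etrans (esym (pairing_nabla_antisym dg ug sg de v w))).
by rewrite (unit_flat D aphi ix v) (unit_flat D aphi ix w) !pairing0l subrr.
Qed.

End DubrovinFrobenius.

(** * The multiplication and the metric in normal-form coordinates *)

Section Components.
Variables (R : realType) (n : nat) (M : complexManifold R n.+2).
Variables (D : DFmanifold M) (m : nat) (phi : chart R n.+2 M).
Hypotheses (aphi : atlas phi) (nf : I2A1_coordinates D m phi).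
Local Notation C := (Cplx R).
Local Notation T := 'rV[C]_n.+2.
Variable x : T.
Hypothesis ix : img phi x.
Local Notation g := (eta D phi x).
Local Notation mul := (circ D phi x).
Local Notation d_ := (partial R).

Lemma circ0l u : mul 0 u = 0.
Proof.
have := mul_linear D aphi ix 1 0 0 u; rewrite !scale1r addr0.
by rewrite -[LHS]addr0 => /addrI.
Qed.

Lemma circDl u v w : mul (u + v) w = mul u w + mul v w.
Proof. by rewrite -[u]scale1r (mul_linear D) // !scale1r. Qed.

Lemma circZl a u w : mul (a *: u) w = a *: mul u w.
Proof. by rewrite -[a *: u]addr0 (mul_linear D) // circ0l addr0. Qed.

Lemma circ_suml I (s : seq I) P (F : I -> T) w :
  mul (\sum_(i <- s | P i) F i) w = \sum_(i <- s | P i) mul (F i) w.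
Proof. by elim/big_rec2: _ => [|i y z _ <-]; rewrite ?circ0l ?circDl. Qed.

Lemma circ_d0 w :
  mul w (d_ 0) = w 0 1 *: d_ 0 + (w 0 0 * x 0 0 ^+ (m - 2)) *: d_ 1.
Proof.
have [[d00 d01 d11] di _] := nf ix.
rewrite {1}(row_sum_delta w) circ_suml big_ord_recl big_ord_recl.
rewrite big1 ?addr0 => [|i _]; last first.
  have [d0i _] := di (lift ord0 (lift ord0 i)) isT.
  by rewrite circZl (mul_comm D) // d0i scaler0.
have -> : lift ord0 ord0 = 1 :> 'I_n.+2 by exact: val_inj.
by rewrite !circZl d00 (mul_comm D) // d01 addrC scalerA.
Qed.

Lemma circ_d1 w : mul w (d_ 1) = w 0 0 *: d_ 0 + w 0 1 *: d_ 1.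
Proof.
have [[d00 d01 d11] di _] := nf ix.
rewrite {1}(row_sum_delta w) circ_suml big_ord_recl big_ord_recl.
rewrite big1 ?addr0 => [|i _]; last first.
  have [_ d1i] := di (lift ord0 (lift ord0 i)) isT.
  by rewrite circZl (mul_comm D) // d1i scaler0.
have -> : lift ord0 ord0 = 1 :> 'I_n.+2 by exact: val_inj.
by rewrite !circZl d01 d11.
Qed.

Lemma circ_di w (i : 'I_n.+2) : (1 < i)%N -> mul w (d_ i) = w 0 i *: d_ i.
Proof.
move=> i1; have [_ di dij] := nf ix; have [d0i d1i] := di i i1.
rewrite {1}(row_sum_delta w) circ_suml (bigD1 i) //= big1 ?addr0 => [|j ji].
  by rewrite circZl dij // eqxx scale1r.
rewrite circZl; have [j1|j1] := ltnP 1 j.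
  by rewrite dij // (negPf ji) scale0r scaler0.
case: j ji j1 => [[|[|j]] ltj] // _ _.
  by rewrite (_ : Ordinal ltj = 0) ?d0i ?scaler0 //; exact: val_inj.
by rewrite (_ : Ordinal ltj = 1) ?d1i ?scaler0 //; exact: val_inj.
Qed.

Lemma circE u v : mul u v = \row_i
  (if i == 0 then u 0 0 * v 0 1 + u 0 1 * v 0 0
   else if i == 1 then x 0 0 ^+ (m - 2) * (u 0 0 * v 0 0) + u 0 1 * v 0 1
   else u 0 i * v 0 i).
Proof.
rewrite (mul_comm D) // {1}(row_sum_delta v) circ_suml.
rewrite (eq_bigr (fun i => v 0 i *: mul u (d_ i))); last first.
  by move=> i _; rewrite circZl (mul_comm D).
rewrite big_ord_recl big_ord_recl.
have -> : lift ord0 ord0 = 1 :> 'I_n.+2 by exact: val_inj.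
rewrite circ_d0 circ_d1; apply/rowP => i; rewrite !mxE summxE.
rewrite (eq_bigr (fun k : 'I_n => v 0 (lift ord0 (lift ord0 k)) *
   (u 0 (lift ord0 (lift ord0 k)) * (i == lift ord0 (lift ord0 k))%:R))); last first.
  by move=> k _; rewrite circ_di // !mxE.
case: (eqVneq i 0) => [->|i0].
  rewrite big1 => [|k _]; last by rewrite mulr0 mulr0.
  by rewrite /= !mulr1 !mulr0 !addr0 addrC [v 0 1 * _]mulrC [v 0 0 * _]mulrC.
case: (eqVneq i 1) => [->|i1].
  rewrite big1 => [|k _]; last by rewrite mulr0 mulr0.
  rewrite /= !mulr1 !mulr0 !addr0 !add0r mulrC -mulrA mulrCA.
  by rewrite [v 0 1 * _]mulrC.
rewrite /= !mulr0 !addr0 !mulr0 !add0r.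
have [k ->] : exists k : 'I_n, i = lift ord0 (lift ord0 k).
  case: i i0 i1 => [[|[|i]] lti] // _ _.
  by exists (Ordinal (lti : (i < n)%N)); exact: val_inj.
rewrite (bigD1 k) //= big1 ?addr0 => [|l lk]; last first.
  by rewrite !(inj_eq lift_inj) eq_sym (negPf lk) !mulr0.
by rewrite eqxx mulr1 mulrC.
Qed.

Lemma unit_fieldE : unit_field D phi x = \row_i (i != 0)%:R.
Proof.
set e := \row_i _.
have eE u : mul e u = u.
  rewrite circE; apply/rowP => i; rewrite !mxE /=.
  case: (eqVneq i 0) => [->|i0]; first by rewrite mul0r add0r mul1r.
  case: (eqVneq i 1) => [->|i1]; first by rewrite mul0r mulr0 add0r mul1r.
  by rewrite mul1r.
by rewrite -[RHS](mul_unit D aphi ix) (mul_comm D) // eE.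
Qed.

(** For non-zero t the algebra is a product of copies of the base field: its characters kill
    nilpotents and together separate vectors. *)
Lemma semisimple_off_caustic k (w : T) :
  x 0 0 != 0 -> iter k (mul w) w = 0 -> w = 0.
Proof.
move=> t0; pose s := sqrtC (x 0 0 ^+ (m - 2)).
have s2 : s ^+ 2 = x 0 0 ^+ (m - 2) by exact: sqrtCK.
have s0 : s != 0 by rewrite sqrtC_eq0 expf_neq0.
have iterE (chi : T -> C) : (forall u v, chi (mul u v) = chi u * chi v) ->
    chi 0 = 0 -> iter k (mul w) w = 0 -> chi w = 0.
  move=> chiM chi0 it.
  have : chi (iter k (mul w) w) = chi w ^+ k.+1.
    by elim: k {it} => [|k IH]; rewrite ?expr1 // iterS chiM IH -exprS.
  by rewrite it chi0 => /esym/eqP; rewrite expf_eq0 => /andP[_ /eqP].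
move=> it.
(* [u_1 + e u_0] is a character of the algebra for both roots e of
   [e^2 = t^(m-2)]. *)
have chi_pm (e : C) : e ^+ 2 = x 0 0 ^+ (m - 2) -> w 0 1 + e * w 0 0 = 0.
  move=> e2; apply: (iterE (fun u => u 0 1 + e * u 0 0)) it => [u v|].
    by rewrite circE !mxE /= -e2; ring.
  by rewrite !mxE mulr0 addr0.
have wp := chi_pm s s2; have wm := chi_pm (- s) _.
have w0 : w 0 0 = 0.
  (* Subtract the relations for the two roots s and - s. *)
  have : 2 * s * w 0 0 = 0.
    by rewrite -[RHS](subrr 0) -{1}wp -wm ?sqrrN //; ring.
  by move=> /eqP; rewrite !mulf_eq0 pnatr_eq0 (negPf s0) => /eqP.
have w1 : w 0 1 = 0 by move: wp; rewrite w0 mulr0 addr0.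
apply/rowP => i; rewrite mxE.
case: (eqVneq i 0) => [->|i0] //; case: (eqVneq i 1) => [->|i1] //.
apply: (iterE (fun u => u 0 i)) it => [u v|]; last by rewrite mxE.
by rewrite circE mxE (negPf i0) (negPf i1).
Qed.

Lemma eta_circ u v w : pairing g (mul u v) w = pairing g u (mul v w).
Proof. exact: eta_mul. Qed.

(** Write [d_ j] as its own square and move one factor across the metric: it annihilates every other
    coordinate field. *)
Lemma eta_offdiag (i j : 'I_n.+2) : i != j -> (1 < j)%N ->
  pairing g (d_ i) (d_ j) = 0.
Proof.
move=> ij j1; have [_ _ dij] := nf ix.
have djj : mul (d_ j) (d_ j) = d_ j by rewrite dij // eqxx scale1r.
rewrite -djj -eta_circ circ_di // mxE eqxx /=.
by rewrite eq_sym (negPf ij) scale0r pairing0l.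
Qed.

Lemma eta00 : pairing g (d_ 0) (d_ 0) = x 0 0 ^+ (m - 2) * pairing g (d_ 1) (d_ 1).
Proof.
have [[d00 d01 d11] _ _] := nf ix.
have -> : pairing g (d_ 0) (d_ 0) = pairing g (mul (d_ 1) (d_ 0)) (d_ 0).
  by rewrite (mul_comm D) // d01.
by rewrite eta_circ d00 pairingZr.
Qed.

End Components.

(** * Chart independence of the caustic *)

Section Caustic.
Variables (R : realType) (n : nat) (M : complexManifold R n) (D : DFmanifold M).

Lemma pushforward0 (phi psi : chart R n M) q :
  same_point phi psi q -> pushforward phi psi q 0 = 0.
Proof.
case=> aphi apsi dphi dpsi; have [hol _] := atlas_compatible aphi apsi.
rewrite /pushforward deriveE ?linear0 //; apply: hol.
by exists q.
Qed.

(** Pushforward preserves the pairing, so a vector in its kernel is orthogonal to everything, hence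
    zero by non-degeneracy. *)
Lemma pushforward_eq0 (phi psi : chart R n M) q v :
  same_point phi psi q -> pushforward phi psi q v = 0 -> v = 0.
Proof.
move=> sp pv0; case: (sp) => aphi apsi dphi dpsi.
have vg0 : v *m eta D phi (coords phi q) = 0.
  apply/rowP => j; rewrite [RHS]mxE.
  have := mt_tensor (eta D) sp v (delta_mx 0 j).
  rewrite pv0 pairing0l /pairing trmx_delta => /esym.
  by rewrite -colE mxE.
have ug : eta D phi (coords phi q) \in unitmx.
  by apply: mt_nondegenerate => //; exists q.
by rewrite -[v](mulmxK ug) vg0 mul0mx.
Qed.

(** A caustic point comes with a nilpotent in some chart only. Pushforward is an injective algebra
    morphism and carries it to the given chart. *)
Lemma caustic_in_chart (phi : chart R n M) q :
    atlas phi -> dom phi q -> caustic D q ->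
  exists v k, v != 0 /\ iter k (circ D phi (coords phi q) v) v = 0.
Proof.
move=> aphi dphi [psi [apsi dpsi [v [v0 [k vk]]]]].
have sp : same_point psi phi q by [].
exists (pushforward psi phi q v), k; split.
  by apply: contra_neq v0; exact: pushforward_eq0.
suff iterE j : iter j (circ D phi (coords phi q) (pushforward psi phi q v))
    (pushforward psi phi q v) =
    pushforward psi phi q (iter j (circ D psi (coords psi q) v) v).
  by rewrite iterE vk pushforward0.
elim: j => [//|j IH]; rewrite !iterS IH; exact: (mul_tensor D sp).
Qed.

End Caustic.

(** * Computation of mu on the plane of d/dt and pi_2 *)

Section NormalForm.
Variables (R : realType) (n : nat) (M : complexManifold R n.+2).
Variables (D : DFmanifold M) (m : nat) (phi : chart R n.+2 M).
Hypotheses (m3 : (3 <= m)%N) (aphi : atlas phi)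
  (nf : I2A1_coordinates D m phi)
  (nE : euler_coordinates (euler D) m phi).
Local Notation C := (Cplx R).
Local Notation T := 'rV[C]_n.+2.
Local Notation d_ := (partial R).
Local Notation g := (eta D phi).

Lemma caustic_t0 q : dom phi q -> caustic D q -> coords phi q 0 0 = 0.
Proof.
move=> dq /(caustic_in_chart aphi dq)[v [k [v0 vk]]].
apply: contraNeq v0 => t0; apply/eqP.
by apply: (semisimple_off_caustic aphi nf _ t0 vk); exists q.
Qed.

Lemma eta_di x (v : T) (i : 'I_n.+2) : img phi x -> (1 < i)%N ->
  pairing (g x) v (d_ i) = v 0 i * pairing (g x) (d_ i) (d_ i).
Proof.
move=> ix i1; rewrite {1}(row_sum_delta v) pairing_suml (bigD1 i) //= pairingZl.
rewrite big1 ?addr0 // => j ji.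
by rewrite pairingZl (eta_offdiag aphi nf ix ji i1) mulr0.
Qed.

Lemma eta_d01 x (v : T) (i : 'I_n.+2) : img phi x -> (i < 2)%N ->
  pairing (g x) v (d_ i) = v 0 0 * pairing (g x) (d_ 0) (d_ i)
                           + v 0 1 * pairing (g x) (d_ 1) (d_ i).
Proof.
move=> ix i2; rewrite {1}(row_sum_delta v) pairing_suml big_ord_recl big_ord_recl.
have -> : lift ord0 ord0 = 1 :> 'I_n.+2 by exact: val_inj.
rewrite big1 => [|j _]; first by rewrite [X in _ + X]addr0 !pairingZl.
rewrite pairingZl pairingC ?(mt_sym (eta D)) //.
rewrite (eta_offdiag aphi nf ix) ?mulr0 //.
by apply: contraTneq i2 => ->.
Qed.

Lemma eulerE x (i : 'I_n.+2) : img phi x ->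
  euler D phi x 0 i = (if i == 0 then 2 / m%:R else 1) * x 0 i.
Proof.
move=> ix; rewrite nE // !mxE summxE.
case: (eqVneq i 0) => [->|i0].
  rewrite big1 ?mulr1 ?addr0 // => j j0.
  by rewrite !mxE [0 == j]eq_sym (negPf j0) andbF mulr0.
rewrite mulr0 add0r (bigD1 i) //= big1 ?addr0 => [|j /andP[_ ji]].
  by rewrite !mxE !eqxx mulr1 mul1r.
by rewrite !mxE [i == j]eq_sym (negPf ji) andbF mulr0.
Qed.

Lemma is_derive_coord (x v : T) i : is_derive x v (fun y : T => y 0 i) (v 0 i).
Proof.
have did : differentiable (@id T) x by exact: ex_diff.
by have := is_derive_entry v 0 i did; rewrite derive_id.
Qed.

Lemma is_derive_eta x v i j : img phi x ->
  is_derive x v (fun y => pairing (g y) (d_ i) (d_ j))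
    (pairing ('D_v g x) (d_ i) (d_ j)).
Proof.
move=> ix; have dg : differentiable g x by exact: mt_holomorphic.
have := is_derive_pairing v (d_ j) dg (@differentiable_cst _ _ _ (d_ i) x).
by rewrite derive_cst pairing0l addr0.
Qed.

(** Near x, eta(e, [d_ j]) equals eta(pi_2, [d_ j]): e has no d/dt component, and pi_i for i >= 3 is
    orthogonal to [d_ j]. *)
Lemma derive_unit_flat x v (j : 'I_n.+2) : img phi x -> (j < 2)%N ->
  'D_v (fun y => pairing (g y) (unit_field D phi y) (d_ j)) x =
  pairing ('D_v g x) (d_ 1) (d_ j).
Proof.
move=> ix j2; have [_ <-] := is_derive_eta v 1 j ix.
apply: near_eq_derive; apply: filterS (near_img ix) => y iy.
rewrite (eta_d01 _ iy j2) (unit_fieldE aphi nf iy) !mxE /=.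
by rewrite mul0r add0r mul1r.
Qed.

(** Only the components (2/m) t and u_2 of E survive the pairing with [d_ j]; the Leibniz rule gives
    two terms for each. *)
Lemma derive_euler_flat x v (j : 'I_n.+2) : img phi x -> (j < 2)%N ->
  'D_v (fun y => pairing (g y) (euler D phi y) (d_ j)) x =
  2 / m%:R * (x 0 0 * pairing ('D_v g x) (d_ 0) (d_ j)
              + pairing (g x) (d_ 0) (d_ j) * v 0 0)
  + (x 0 1 * pairing ('D_v g x) (d_ 1) (d_ j)
     + pairing (g x) (d_ 1) (d_ j) * v 0 1).
Proof.
move=> ix j2.
have [_ <-] := is_deriveD
  (is_deriveZ (2 / m%:R)
    (is_deriveM (is_derive_coord x v 0) (is_derive_eta v 0 j ix)))
  (is_deriveM (is_derive_coord x v 1) (is_derive_eta v 1 j ix)).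
apply: near_eq_derive; apply: filterS (near_img ix) => y iy.
rewrite (eta_d01 _ iy j2) !eulerE //= mul1r.
by rewrite -[2 / m%:R * _ * _]mulrA.
Qed.

Lemma mu01 x : img phi x -> x 0 0 = 0 ->
  pairing (g x) (mu_endo D phi x (d_ 0)) (d_ 1) =
  (1 - 2 / m%:R) / 2 * pairing (g x) (d_ 1) (d_ 0).
Proof.
move=> ix t0.
have lt02 : ((0 : 'I_n.+2)%R < 2)%N by [].
have lt12 : ((1 : 'I_n.+2)%R < 2)%N by [].
(* Closedness of eta(e, -) equates the two metric derivatives that u_2 multiplies below. *)
have de := etrans (esym (derive_unit_flat (d_ 0) ix lt12))
  (etrans (unit_flat_closed D aphi ix (d_ 0) (d_ 1))
          (derive_unit_flat (d_ 1) ix lt02)).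
apply: (etrans (pairing_mu D aphi ix _ _)).
apply: (etrans (congr2 (fun a b => - 2^-1 * (a - b))
  (derive_euler_flat (d_ 0) ix lt12) (derive_euler_flat (d_ 1) ix lt02))).
move: de; move: ('D_(d_ 0) g x) ('D_(d_ 1) g x) => A B ->.
(* Since m >= 3, the exponent m - 2 is positive and 0^(m-2) = 0. *)
rewrite t0 (eta00 aphi nf ix) t0 expr0n subn_eq0 leqNgt m3 mul0r.
rewrite (pairingC (d_ 0) (d_ 1)) ?(mt_sym (eta D)) // !mxE /=.
rewrite !mul0r !mulr0 !mulr1 !add0r !addr0.
move: (pairing _ _ _) (x 0 1 * _) (2 / m%:R) => a b c.
by ring.
Qed.

End NormalForm.

(** * The orthonormal frame along the caustic and the matrices U and V *)

Section CausticFrame.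
Variables (R : realType) (n : nat) (M : complexManifold R n.+2).
Variables (D : DFmanifold M) (m : nat) (phi : chart R n.+2 M) (q : M).
Hypotheses (m3 : (3 <= m)%N) (aphi : atlas phi) (dq : dom phi q)
  (nf : I2A1_coordinates D m phi)
  (nE : euler_coordinates (euler D) m phi)
  (t0 : coords phi q 0 0 = 0)
  (nd : caustic_pullback_nondegenerate D phi q).
Local Notation C := (Cplx R).
Local Notation T := 'rV[C]_n.+2.
Local Notation d_ := (partial R).
Local Notation x := (coords phi q).
Local Notation g := (eta D phi x).
Local Notation mul := (circ D phi x).
Variables (N : T) (r : 'I_n.+2 -> C).
Hypotheses (uN : is_unit_normal D phi q N) (lr : are_lengths D phi q r).
Local Notation f := (frame N r).

Let ix : img phi x. Proof. by exists q. Qed.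

Let gC u v : pairing g u v = pairing g v u.
Proof. by apply: pairingC; exact: mt_sym. Qed.

Let partial_t (i : 'I_n.+2) : i != 0 -> d_ i 0 0 = 0.
Proof. by move=> i0; rewrite mxE eq_sym (negPf i0). Qed.

Let ge2 (i : 'I_n.+2) : i != 0 -> i != 1 -> (1 < i)%N.
Proof. by case: i => [[|[|i]] lti]. Qed.

Let one0 : (1 : 'I_n.+2) != 0. Proof. by []. Qed.

Let eta00_0 : pairing g (d_ 0) (d_ 0) = 0.
Proof. by rewrite (eta00 aphi nf ix) t0 expr0n subn_eq0 leqNgt m3 mul0r. Qed.

Let eta_d1 v : pairing g v (d_ 1) =
  v 0 0 * pairing g (d_ 1) (d_ 0) + v 0 1 * pairing g (d_ 1) (d_ 1).
Proof.
by rewrite (eta_d01 aphi nf v ix (isT : ((1 : 'I_n.+2)%R < 2)%N)) (gC (d_ 0)).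
Qed.

(** A [d_ i] of length zero would be orthogonal to the whole tangent space of the caustic, against
    non-degeneracy of the pullback. *)
Lemma length_neq0 i : i != 0 -> r i != 0.
Proof.
move=> i0; rewrite -sqrf_eq0 lr //; apply/eqP => gi0.
have : d_ i = 0.
  apply: nd => [|v v0]; first exact: partial_t.
  rewrite gC; have [i1|i1] := eqVneq i 1.
    by move: gi0; rewrite i1 => gi0; rewrite eta_d1 v0 mul0r add0r gi0 mulr0.
  by rewrite (eta_di aphi nf v ix (ge2 i0 i1)) gi0 mulr0.
move=> /(congr1 (fun u : T => u 0 i)); rewrite !mxE !eqxx => /eqP.
by rewrite oner_eq0.
Qed.

Lemma normal_components (i : 'I_n.+2) : (1 < i)%N -> N 0 i = 0.
Proof.
move=> i1; have i0 : i != 0 by apply: contraTneq i1 => ->.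
have := uN.2 (d_ i) (partial_t i0); rewrite (eta_di aphi nf N ix i1) -lr //.
by move=> /eqP; rewrite mulf_eq0 sqrf_eq0 (negPf (length_neq0 i0)) orbF => /eqP.
Qed.

Lemma normal_orth1 :
  N 0 0 * pairing g (d_ 1) (d_ 0) = - (N 0 1 * r 1 ^+ 2).
Proof.
have := uN.2 (d_ 1) (partial_t one0); rewrite eta_d1 -lr // => /eqP.
by rewrite addr_eq0 => /eqP.
Qed.

Lemma normal_decomp : N = N 0 0 *: d_ 0 + N 0 1 *: d_ 1.
Proof.
apply/rowP => i; rewrite !mxE /=.
case: (eqVneq i 0) => [->|i0] /=; first by rewrite mulr1 mulr0 addr0.
case: (eqVneq i 1) => [->|i1] /=; first by rewrite mulr1 mulr0 add0r.
by rewrite !mulr0 addr0; apply: normal_components; exact: ge2.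
Qed.

(** With N = a d/dt + b pi_2 and d/dt isotropic, 1 = eta(N, N) = a b eta(d/dt, pi_2), and
    orthogonality to pi_2 turns this into - b^2 [r 1]^2. *)
Lemma normal_sqr : (N 0 1 * r 1) ^+ 2 = -1.
Proof.
have := uN.1; rewrite {2}normal_decomp pairingDr !pairingZr.
rewrite (uN.2 (d_ 1)) ?partial_t // mulr0 addr0.
rewrite (eta_d01 aphi nf N ix (isT : ((0 : 'I_n.+2)%R < 2)%N)) eta00_0 mulr0 add0r.
rewrite mulrCA normal_orth1 => <-.
by rewrite mulrN opprK mulrA -expr2 exprMn.
Qed.

Lemma frame_orthonormal i j : pairing g (f i) (f j) = (i == j)%:R.
Proof.
have di0 k : k != 0 -> pairing g (d_ k) N = 0.
  by move=> k0; rewrite gC; apply: uN.2; exact: partial_t.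
rewrite /frame; case: (eqVneq i 0) => i0; case: (eqVneq j 0) => j0.
- by rewrite i0 j0 eqxx uN.1.
- by rewrite pairingZr gC di0 // mulr0 i0 eq_sym (negPf j0).
- by rewrite pairingZl di0 // mulr0 j0 (negPf i0).
rewrite pairingZl pairingZr; have [<-|ij] := eqVneq i j.
  by rewrite -lr // expr2 mulKf ?mulVf ?length_neq0.
have [j1|j1] := ltnP 1 j.
  by rewrite (eta_offdiag aphi nf ix ij j1) !mulr0.
have [i1|i1] := ltnP 1 i.
  by rewrite gC (eta_offdiag aphi nf ix _ i1) ?mulr0 // eq_sym.
have le1 (k : 'I_n.+2) : k != 0 -> (k <= 1)%N -> k = 1.
  by case: k => [[|[|k]] ltk] // _ _; exact: val_inj.
by move: ij; rewrite (le1 i) // (le1 j) // eqxx.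
Qed.

(** At t = 0 the field E has no d/dt component, and pi_2 is the identity on the span of d/dt and
    pi_2, which contains N. So index 0 repeats the eigenvalue u_2 of index 1. *)
Lemma euler_frame j :
  mul (euler D phi x) (f j) = x 0 (if j == 0 then 1 else j) *: f j.
Proof.
have E00 : euler D phi x 0 0 = 0 by rewrite (eulerE nE _ ix) t0 mulr0.
have E0i i : i != 0 -> euler D phi x 0 i = x 0 i.
  by move=> i0; rewrite (eulerE nE _ ix) (negPf i0) mul1r.
rewrite /frame; case: (eqVneq j 0) => [_|j0].
  rewrite (circE aphi nf ix) E00 !mul0r !mulr0 !add0r E0i //.
  apply/rowP => i; rewrite !mxE; case: (eqVneq i 0) => [->|i0] //.
  case: (eqVneq i 1) => [->|i1] //.
  by rewrite (normal_components (ge2 i0 i1)) !mulr0.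
rewrite (mul_comm D) // (circZl D aphi ix) (mul_comm D) // scalerA mulrC -scalerA.
congr (_ *: _); have [->|j1] := eqVneq j 1.
  by rewrite (circ_d1 aphi nf ix) E00 scale0r add0r E0i.
by rewrite (circ_di aphi nf ix _ (ge2 j0 j1)) E0i.
Qed.

Lemma UmxE i j :
  Umx D phi q f i j = x 0 (if j == 0 then 1 else j) * (i == j)%:R.
Proof. by rewrite /Umx !mxE euler_frame pairingZr frame_orthonormal. Qed.

Lemma VmxC i j : Vmx D phi q f j i = - Vmx D phi q f i j.
Proof.
rewrite /Vmx !mxE; apply: (etrans (gC _ _)).
rewrite (pairing_mu_antisym D aphi ix); congr (- _); exact: gC.
Qed.

Lemma Vmx_diag0 i : Vmx D phi q f i i = 0.
Proof.
have /eqP := VmxC i i; rewrite -addr_eq0 -mulr2n mulrn_eq0 /=.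
by move/eqP.
Qed.

(** By antisymmetry of mu only the d/dt part of N contributes; [normal_orth1] then trades eta(d/dt,
    pi_2) for the length of pi_2. *)
Lemma Vmx10 :
  Vmx D phi q f 1 0 = - (N 0 1 * r 1) * ((1 - 2 / m%:R) / 2).
Proof.
have mu11 : pairing g (mu_endo D phi x (d_ 1)) (d_ 1) = 0.
  have /eqP := pairing_mu_antisym D aphi ix (d_ 1) (d_ 1).
  by rewrite -addr_eq0 -mulr2n mulrn_eq0 /= => /eqP.
have mu10 : pairing g (mu_endo D phi x (d_ 1)) (d_ 0) =
    - ((1 - 2 / m%:R) / 2 * pairing g (d_ 1) (d_ 0)).
  by rewrite (pairing_mu_antisym D aphi ix) (mu01 m3 aphi nf nE ix t0).
have r0 : r 1 != 0 by exact: length_neq0.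
rewrite /Vmx mxE /frame /= pairingZl gC (pairing_mu_antisym D aphi ix).
rewrite {1}normal_decomp pairingDr !pairingZr mu11 mu10 mulr0 addr0.
rewrite !mulrN opprK (mulrCA (N 0 0)) normal_orth1 !mulrN mulNr.
congr (- _); rewrite mulrCA [RHS]mulrC; congr (_ * _).
by rewrite mulrCA expr2 mulKf.
Qed.

(** This sign cancels the pi_2 component of w, leaving a multiple of d/dt, whose square is 0 at t =
    0. *)
Lemma normal_nilpotent : N 0 1 * r 1 = - 'i ->
  let w := N + 'i *: frame N r 1 in mul w w = 0.
Proof.
move=> Nr /=; have r0 : r 1 != 0 by exact: length_neq0.
set w := N + _.
have w1 : w 0 1 = 0.
  rewrite /w /frame /= !mxE /= mulr1.
  by rewrite -[N 0 1](mulfK r0) Nr mulNr addNr.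
have wi (i : 'I_n.+2) : i != 0 -> w 0 i = 0.
  move=> i0; have [->//|i1] := eqVneq i 1.
  rewrite /w /frame /= !mxE (negPf i1) andbF !mulr0 addr0.
  exact: normal_components (ge2 i0 i1).
clearbody w; rewrite (circE aphi nf ix); apply/rowP => i.
rewrite !mxE w1 !mulr0 mul0r addr0.
case: (eqVneq i 0) => // i0; case: (eqVneq i 1) => // _.
  by rewrite t0 expr0n subn_eq0 leqNgt m3 mul0r addr0.
by rewrite wi // mul0r.
Qed.

End CausticFrame.

(** * The exponent of formal monodromy *)

Theorem proposition5p3 (R : realType) (n : nat) (M : complexManifold R n.+2)
    (D : DFmanifold M) (m : nat) (p : M) (phi : chart R n.+2 M) :
  (3 <= m)%N ->
  caustic D p ->
  atlas phi -> dom phi p ->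
  I2A1_coordinates D m phi ->
  euler_coordinates (euler D) m phi ->
  (forall q, caustic D q -> dom phi q ->
     caustic_pullback_nondegenerate D phi q) ->
  forall q, caustic D q -> dom phi q ->
  forall (N0 : 'rV[Cplx R]_n.+2) (r : 'I_n.+2 -> Cplx R),
    is_unit_normal D phi q N0 -> are_lengths D phi q r ->
  exists N : 'rV[Cplx R]_n.+2,
    (* the sign of the unit normal, singled out by N + i f_2 being nilpotent *)
    [/\ N = N0 \/ N = - N0,
        (let w := N + 'i *: frame N r 1 in circ D phi (coords phi q) w w = 0) &
        let f := frame N r in
        let U := Umx D phi q f in
        let V := Vmx D phi q f in
        let c : Cplx R := (m%:R - 2) / m%:R in
        let a := 'i / 2 * c in
        [/\ V 1 0 = a, V 0 1 = - a &
            forall B1 B : 'M[Cplx R]_n.+2, formal_monodromy U V B1 B ->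
              B1 = a *: delta_mx 1 0 - a *: delta_mx 0 1 /\
              B = (c / 2) *: delta_mx 0 0 - (c / 2) *: delta_mx 1 1]].
Proof.
move=> m3 _ aphi _ nf nE nd q cq dq N0 r uN0 lr.
have t0 := caustic_t0 aphi nf dq cq.
have [N [NN0 uN Nr]] : exists N, [/\ N = N0 \/ N = - N0,
    is_unit_normal D phi q N & N 0 1 * r 1 = - 'i].
  have := normal_sqr m3 aphi dq nf t0 (nd q cq dq) uN0 lr.
  (* The product [N0 0 1 * r 1] is a square root of -1; when it is ['i], the opposite normal is
     taken. *)
  rewrite -(sqrCi (Cplx R)) => /eqP; rewrite eqf_sqr => /orP[] /eqP Nr.
    exists (- N0); split; [by right| |by rewrite mxE mulNr Nr].
    split=> [|v v0]; rewrite pairingNl ?pairingNr ?opprK; first exact: uN0.1.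
    by rewrite (uN0.2 v v0) oppr0.
  by exists N0; split=> //; left.
have {nd} ndq := nd q cq dq.
exists N; split=> //.
  exact: (normal_nilpotent m3 aphi dq nf t0 ndq uN lr Nr).
move=> f U V c a.
have V10 : V 1 0 = a.
  rewrite /V (Vmx10 m3 aphi dq nf nE t0 ndq uN lr) Nr opprK /a /c.
  have m0 : m%:R != 0 :> Cplx R by rewrite pnatr_eq0 -lt0n (leq_trans _ m3).
  by rewrite -mulrA; congr (_ * _); rewrite mulrC mulrBl divff.
have V01 : V 0 1 = - a by rewrite -V10; exact: VmxC.
split=> // B1 B [G [Bs [H [[G0 Bs0 Bs1 gG] bBs [uH bH gH] dB B00]]]].
have dU : is_diag_mx U.
  apply/is_diag_mxP => i j ij.
  by rewrite /U (UmxE aphi dq nf nE t0 ndq uN lr) (negPf (ij : i != j)) mulr0.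
have U01 : U 0 0 = U 1 1.
  by rewrite /U !(UmxE aphi dq nf nE t0 ndq uN lr) !eqxx.
have V0 i : V i i = 0 by exact: Vmx_diag0.
have B1E : B1 = V 0 1 *: delta_mx 0 1 + V 1 0 *: delta_mx 1 0.
  by rewrite -Bs1; exact: (block_residue dU U01 _ _ _ G0 Bs0 gG (bBs _)).
split; first by rewrite B1E V01 V10 scaleNr addrC.
have HB := residue_conjugation Bs0 gH; rewrite Bs1 in HB.
rewrite [LHS](diag_conjugate_block uH (bH _) dB B1E HB) scalerBr B00 V01.
(* The left side is [B 0 0], by the chosen order of the eigenvalues. *)
have -> // : 'i * - a = c / 2.
rewrite /a mulrN !mulrA -expr2 sqrCi mulN1r.
by rewrite !mulNr opprK -mulrA mulrC.
Qed.
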